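(* Let $N$ be a binary-conflict-free net. Then there is exactly one maximal (with respect to set inclusion) FS-run of $N$.
   Context: **Multisets.** A multiset over $X$ is a function $A:X\to\mathbb N$; $x\in A$ iff $A(x)>0$; $A\subseteq B$ iff $A(x)\le B(x)$ for all $x$; $+$ is pointwise; $(A-B)(x)=\max(A(x)-B(x),0)$; $|A|=\sum_x A(x)$; $A\restriction Y$ is the restriction to $Y$; multisets on different domains are identified if they agree after extension by $0$; $\{t,u\}$ denotes a multiset. **Nets.** A net is $N=(S,T,F,M_0)$ with $S,T$ disjoint sets (places, transitions), $F:(S\times T)\cup(T\times S)\to\mathbb N$ and $M_0:S\to\mathbb N$, such that for each $t\in T$ the set $\{s\mid F(s,t)>0\}$ is finite and non-empty and $\{s\mid F(t,s)>0\}$ is finite. ${}^\bullet x(y)=F(y,x)$, $x^\bullet(y)=F(x,y)$, extended additively to multisets. Markings are elements of $\mathbb N^S$. For finite non-empty $G\in\mathbb N^T$, $M\xrightarrow{G}M'$ iff ${}^\bullet G\subseteq M$ and $M'=(M-{}^\bullet G)+G^\bullet$. For $\sigma=t_1\cdots t_n\in T^*$, $M\xrightarrow{\sigma}M'$ means $M\xrightarrow{\{t_1\}}M_1\cdots\xrightarrow{\{t_n\}}M'$ for some intermediate markings; omitted targets are existentially quantified. $M$ is reachable iff $M_0\xrightarrow{\sigma}M$ for some $\sigma\in T^*$. $\mathrm{FS}(N)=\{\sigma\in T^*\mid M_0\xrightarrow{\sigma}\}$ is the set of firing sequences. **Conflict.** A finite non-empty $G\in\mathbb N^T$ is in conflict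 in $M$ iff $M\xrightarrow{G\restriction\{t\}}$ for all $t\in G$ but not $M\xrightarrow{G}$. $N$ is binary-conflict-free iff no multiset $G\in\mathbb N^T$ with $|G|=2$ is in conflict in any reachable marking. **FS-runs.** For $\sigma,\rho\in\mathrm{FS}(N)$: $\sigma\leftrightarrow\rho$ (adjacent) iff $\sigma=\sigma_1tu\sigma_2$, $\rho=\sigma_1ut\sigma_2$ and $M_0\xrightarrow{\sigma_1}M\xrightarrow{\{t,u\}}$ for some $M$. $\leftrightarrow^*$ is the reflexive transitive closure and $[\sigma]$ the $\leftrightarrow^*$-class of $\sigma$. A partial FS-run is a $\leftrightarrow^*$-class. $[\sigma]\le[\rho]$ ($[\sigma]$ is a prefix of $[\rho]$) iff there is $\mu$ with $\sigma$ a prefix of $\mu$ and $\mu\leftrightarrow^*\rho$. An FS-run of $N$ is a non-empty set of partial FS-runs that is prefix-closed (downward closed under $\le$) and directed (any two elements have an upper bound in the set under $\le$). *)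

(* Defs.v *)
From Stdlib Require Import Relation_Operators.
From mathcomp Require Import all_boot finmap multiset.
From mathcomp Require Import boolp classical_sets cardinality.
Set Implicit Arguments.
Unset Strict Implicit.
Unset Printing Implicit Defensive.

Local Open Scope mset_scope.
Local Open Scope classical_set_scope.
Local Open Scope nat_scope.

(* Places and transitions are disjoint because they live in different types.
   Finite multisets of transitions are elements of {mset transition}; the
   choiceType structure this needs is no restriction, since classically every
   type T carries one (the alias {classic T}).  Markings may have infinite
   support, so they are plain functions.
   [flow_in s t] is F(s,t) and [flow_out t s] is F(t,s). *)
Record net := Net {
  place : Type;
  transition : choiceType;
  flow_in : place -> transition -> nat;
  flow_out : transition -> place -> nat;
  initial : place -> nat;
  flow_in_finite : forall t, finite_set [set s | 0 < flow_in s t];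
  flow_in_neq0 : forall t, [set s | 0 < flow_in s t] !=set0;
  flow_out_finite : forall t, finite_set [set s | 0 < flow_out t s] }.

Section Nets.
Variable N : net.

Definition marking := place N -> nat.

(* A sum over the elements of a multiset counts multiplicities. *)
Definition preset (G : {mset transition N}) : marking :=
  fun s => \sum_(t <- G) flow_in s t.
Definition postset (G : {mset transition N}) : marking :=
  fun s => \sum_(t <- G) flow_out t s.

Definition step (M : marking) (G : {mset transition N}) (M' : marking) : Prop :=
  [/\ G <> mset0,
      forall s, preset G s <= M s &
      M' = (fun s => (M s - preset G s) + postset G s)].

Definition enabled (M : marking) (G : {mset transition N}) : Prop :=
  exists M', step M G M'.

Fixpoint fires (M : marking) (sigma : seq (transition N)) (M' : marking) : Prop :=
  if sigma is t :: sigma' then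
    exists2 M1, step M [mset t] M1 & fires M1 sigma' M'
  else M' = M.

Definition reachable (M : marking) : Prop :=
  exists sigma, fires (@initial N) sigma M.

Definition FS : set (seq (transition N)) :=
  [set sigma | exists M, fires (@initial N) sigma M].

(* [msetn (G t) t] is the restriction of G to {t}. *)
Definition in_conflict (G : {mset transition N}) (M : marking) : Prop :=
  [/\ G <> mset0,
      forall t, t \in G -> enabled M (msetn (G t) t) &
      ~ enabled M G].

Definition binary_conflict_free : Prop :=
  forall (G : {mset transition N}) (M : marking),
    size G = 2 -> reachable M -> ~ in_conflict G M.

Definition adjacent (sigma rho : seq (transition N)) : Prop :=
  [/\ FS sigma, FS rho &
      exists sigma1 t u sigma2,
        [/\ sigma = sigma1 ++ [:: t, u & sigma2],
            rho = sigma1 ++ [:: u, t & sigma2] &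
            exists2 M, fires (@initial N) sigma1 M & enabled M [mset t; u]]].

Definition adjacent_star : seq (transition N) -> seq (transition N) -> Prop :=
  clos_refl_trans _ adjacent.

(* The class of sigma; only used for sigma in FS, in which case it is a subset
   of FS.  Adjacency is symmetric, so this is an equivalence class. *)
Definition FS_class (sigma : seq (transition N)) : set (seq (transition N)) :=
  [set rho | adjacent_star sigma rho].

Definition partial_FS_run : set (set (seq (transition N))) :=
  [set C | exists2 sigma, FS sigma & C = FS_class sigma].

Definition run_prefix (C D : set (seq (transition N))) : Prop :=
  exists sigma rho,
    [/\ FS sigma, FS rho, C = FS_class sigma, D = FS_class rho &
        exists2 mu, prefix sigma mu & adjacent_star mu rho].

Definition FS_run (R : set (set (seq (transition N)))) : Prop :=
  [/\ R `<=` partial_FS_run,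
      R !=set0,
      forall C D, R D -> run_prefix C D -> R C &
      forall C D, R C -> R D ->
        exists2 E, R E & run_prefix C E /\ run_prefix D E].

Definition maximal_FS_run (R : set (set (seq (transition N)))) : Prop :=
  FS_run R /\ forall R', FS_run R' -> R `<=` R' -> R' = R.

End Nets.

(* Main.v *)
(* Two distinct transitions enabled at a reachable marking of a
   binary-conflict-free net can be fired together, hence in either order, and
   the two orders are adjacent.  This diamond property extends to firing
   sequences: any two have extensions in the same [adjacent_star]-class.  So the
   set of all partial FS-runs is directed; it is the greatest FS-run. *)
Require Import Defs.
From Stdlib Require Import Relation_Operators.
From mathcomp Require Import all_boot finmap multiset zify.
From mathcomp Require Import boolp classical_sets.
Set Implicit Arguments.
Unset Strict Implicit.
Unset Printing Implicit Defensive.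

Local Open Scope mset_scope.
Local Open Scope classical_set_scope.
Local Open Scope nat_scope.

(** A multiset is enumerated in an unspecified order, so sums over the pair and its size are
    computed up to permutation. *)
Lemma perm_mset2 (T : choiceType) (t u : T) : perm_eq [mset t; u] [:: t; u].
Proof.
have -> : [mset t; u] = seq_mset [:: t; u].
  by apply/msetP => x; rewrite mset_seqE mset1DE msetnE /= addn0 ![_ == x]eq_sym; case: (x == u).
exact: perm_eq_seq_mset.
Qed.

Lemma mset1_neq0 (T : choiceType) (t : T) : [mset t] <> mset0.
Proof. by move/msetP/(_ t); rewrite msetnxx mset0E. Qed.

Lemma mset2_neq0 (T : choiceType) (t u : T) : [mset t; u] <> mset0.
Proof. by move/msetP/(_ t); rewrite mset1DE eqxx mset0E. Qed.

Section Nets.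
Variable N : net.
Implicit Types (M : marking N) (t u : transition N).
Implicit Types (s r a b p : seq (transition N)).

Lemma preset1 t : preset [mset t] = fun x => flow_in x t.
Proof. by apply: funext => x; rewrite /preset enum_msetn big_seq1. Qed.

Lemma postset1 t : postset [mset t] = flow_out t.
Proof. by apply: funext => x; rewrite /postset enum_msetn big_seq1. Qed.

Lemma preset2 t u x : preset [mset t; u] x = flow_in x t + flow_in x u.
Proof. by rewrite /preset (perm_big _ (perm_mset2 t u)) big_cons big_seq1. Qed.

Lemma step1P M t M' :
  step M [mset t] M' <->
  (forall x, flow_in x t <= M x) /\ M' = fun x => M x - flow_in x t + flow_out t x.
Proof.
rewrite /step preset1 postset1; split => [[] //|[? ?]].
by split=> //; exact: mset1_neq0.
Qed.

Lemma step1_det M t M1 M2 : step M [mset t] M1 -> step M [mset t] M2 -> M1 = M2.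
Proof. by move=> /step1P[_ ->] /step1P[_ ->]. Qed.

Lemma enabled2P M t u :
  enabled M [mset t; u] <-> forall x, flow_in x t + flow_in x u <= M x.
Proof.
split=> [[M' [_ le _]] x|le]; first by rewrite -preset2.
eexists; split; [exact: mset2_neq0 | by move=> x; rewrite preset2 | reflexivity].
Qed.

Lemma enabled2C M t u : enabled M [mset t; u] -> enabled M [mset u; t].
Proof. by move=> /enabled2P le; apply/enabled2P => x; rewrite addnC. Qed.

(** The marking covers both presets at once, so neither firing takes tokens the other needs and the
    truncated subtractions are exact; hence the effects commute. *)
Lemma enabled2_diamond M t u M1 M2 :
  enabled M [mset t; u] -> step M [mset t] M1 -> step M [mset u] M2 ->
  exists2 M', step M1 [mset u] M' & step M2 [mset t] M'.
Proof.
move=> /enabled2P le /step1P[_ ->] /step1P[_ ->].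
eexists; apply/step1P; split; try reflexivity.
- by move=> x; move: (le x); lia.
- by move=> x; move: (le x); lia.
- by apply: funext => x; move: (le x); lia.
Qed.

Lemma enabled2_fires M t u M' r :
  enabled M [mset t; u] -> fires M [:: t, u & r] M' -> fires M [:: u, t & r] M'.
Proof.
move=> en [M1 st [M2 su fr]].
have [M3 su3] : enabled M [mset u].
  eexists; apply/step1P; split; last reflexivity.
  by move=> x; move/enabled2P/(_ x): en; lia.
have [M4 su4 st4] := enabled2_diamond en st su3.
by exists M3 => //; exists M4 => //; rewrite -(step1_det su su4).
Qed.

Lemma fires_cat M s r M' :
  fires M (s ++ r) M' <-> exists2 M1, fires M s M1 & fires M1 r M'.
Proof.
elim: s M => [|t s IH] M /=; first by split=> [?|[_ ->]]; [exists M|].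
split=> [[M1 st /IH[M2 ? ?]]|[M2 [M1 ? ?] ?]].
  by exists M2 => //; exists M1.
by exists M1 => //; apply/IH; exists M2.
Qed.

Lemma fires_det M s M1 M2 : fires M s M1 -> fires M s M2 -> M1 = M2.
Proof.
elim: s M => [|t s IH] M /=; first by move=> -> ->.
by move=> [M3 st f1] [M4 st' f2]; apply: IH f1 _; rewrite (step1_det st st').
Qed.

Lemma FS_catl s r : FS (s ++ r) -> FS s.
Proof. by move=> [M /fires_cat[M1 ? _]]; exists M1. Qed.

Lemma adjacent_FS_catl s r a : adjacent s r -> FS (s ++ a) -> FS (r ++ a).
Proof.
move=> [_ _ [b [t [u [c [-> -> [M fM en]]]]]]] [M']; rewrite -!catA /=.
move=> /fires_cat[M1 f1 f2]; exists M'; apply/fires_cat.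
by exists M1 => //; apply: enabled2_fires f2; rewrite (fires_det f1 fM).
Qed.

Lemma adjacent_catr s r a : adjacent s r -> FS (s ++ a) -> adjacent (s ++ a) (r ++ a).
Proof.
move=> sr Fsa; split=> //; first exact: adjacent_FS_catl sr Fsa.
case: sr => _ _ [b [t [u [c [-> -> en]]]]].
by exists b, t, u, (c ++ a); rewrite -!catA.
Qed.

(** Adjacent sequences reach the same marking, so they admit the same continuations. [FS (r ++ a)]
    is part of the conclusion because the transitivity case needs it for the second half of the
    chain. *)
Lemma adjacent_star_catr s r a :
  adjacent_star s r -> FS (s ++ a) ->
  FS (r ++ a) /\ adjacent_star (s ++ a) (r ++ a).
Proof.
elim=> {s r} [s r sr|s|s r p _ IH1 _ IH2] Fs.
- by split; [exact: adjacent_FS_catl sr Fs | exact/rt_step/adjacent_catr].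
- by split=> //; exact: rt_refl.
- have [/IH2[Fp rp] sr] := IH1 Fs.
  by split=> //; exact: rt_trans sr rp.
Qed.

Lemma adjacent_star_FS s r : adjacent_star s r -> FS s -> FS r.
Proof.
by move=> sr Fs; have := @adjacent_star_catr _ _ [::] sr; rewrite !cats0 => -[].
Qed.

Lemma run_prefix_catr s r a :
  FS (s ++ a) -> adjacent_star (s ++ a) r ->
  run_prefix (FS_class s) (FS_class r).
Proof.
move=> Fs sr; exists s, r; split=> //; first exact: FS_catl Fs.
  exact: adjacent_star_FS sr Fs.
by exists (s ++ a) => //; exact: prefix_prefix.
Qed.

Hypothesis bcf : binary_conflict_free N.

Lemma bcf_enabled2 M t u :
  t <> u -> reachable M -> enabled M [mset t] -> enabled M [mset u] ->
  enabled M [mset t; u].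
Proof.
move=> /eqP tu rM et eu; apply: contrapT => nen.
apply: (bcf (G := [mset t; u]) (M := M)) => //.
  by rewrite (perm_size (perm_mset2 t u)).
split=> //; first exact: mset2_neq0.
(* As [t] and [u] differ, each has multiplicity 1 in the pair, so the restrictions are the
   singletons, enabled by assumption. *)
move=> x; rewrite in_mset2 => /orP[] /eqP ->; rewrite mset1DE msetnE eqxx.
  by rewrite (negbTE tu).
by rewrite eq_sym (negbTE tu).
Qed.

Lemma FS_diamond s t u :
  t <> u -> FS (rcons s t) -> FS (rcons s u) ->
  adjacent (s ++ [:: u; t]) (s ++ [:: t; u]).
Proof.
move=> tu; rewrite -!cats1 => -[_ /fires_cat[M fM [M1 st _]]].
move=> [_ /fires_cat[M' fM' [M2 su _]]].
move: fM' su => /(fires_det fM) <- su.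
have en : enabled M [mset t; u].
  by apply: bcf_enabled2 => //; [exists s | exists M1 | exists M2].
have [M3 su3 st3] := enabled2_diamond en st su.
split.
- by exists M3; apply/fires_cat; exists M => //; exists M2 => //; exists M3.
- by exists M3; apply/fires_cat; exists M => //; exists M1 => //; exists M3.
- exists s, u, t, [::]; split=> //.
  by exists M => //; exact: enabled2C.
Qed.

(** Induction on [r] pushes [t] along it by diamonds. If [t] meets its own occurrence it is absorbed
    and [b] is empty; if it reaches the end, it is left over as [b]. *)
Lemma FS_strip s t r :
  FS (rcons s t) -> FS (s ++ r) ->
  exists a b, FS (rcons s t ++ a) /\ adjacent_star (rcons s t ++ a) (s ++ r ++ b).
Proof.
elim: r s => [|u r IH] s Ft Fr.
  by exists [::], [:: t]; rewrite /= cats0 cats1; split=> //; exact: rt_refl.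
have [->|/eqP tu] := eqVneq t u.
  by exists r, [::]; rewrite cats0 cat_rcons; split=> //; exact: rt_refl.
have Fu : FS (rcons s u) by apply: (@FS_catl _ r); rewrite cat_rcons.
have adj := FS_diamond tu Ft Fu.
rewrite -cat_rcons in Fr.
have Fut : FS (rcons (rcons s u) t) by rewrite -cats1 cat_rcons; case: adj.
have [a [b [Fa ab]]] := IH _ Fut Fr.
(* Both orientations serve: [adj] carries firability over to the order [t], [u], and [adj'] is the
   first link of the chain back to the order [u], [t], where the induction hypothesis applies. *)
have adj' := FS_diamond (nesym tu) Fu Ft.
have e v w c : rcons (rcons s v) w ++ c = (s ++ [:: v; w]) ++ c.
  by rewrite !cat_rcons -catA.
rewrite e in Fa ab; exists (u :: a), b.
have -> : rcons s t ++ u :: a = (s ++ [:: t; u]) ++ a by rewrite cat_rcons -catA.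
have Fa' := adjacent_FS_catl adj Fa; split=> //.
apply: rt_trans (rt_step _ _ _ _ (adjacent_catr adj' Fa')) _.
by rewrite cat_rcons in ab.
Qed.

(** Strips are stacked, one for each transition of [s]. The common prefix [p] is general because it
    grows with each strip. *)
Lemma FS_confluent p s r :
  FS (p ++ s) -> FS (p ++ r) ->
  exists a b, FS (p ++ s ++ a) /\ adjacent_star (p ++ s ++ a) (p ++ r ++ b).
Proof.
elim: s p r => [|t s IH] p r Fs Fr.
  by exists r, [::]; rewrite cats0; split=> //; exact: rt_refl.
rewrite -cat_rcons in Fs.
have [c [d [Fc cd]]] := FS_strip (FS_catl Fs) Fr.
have [a [b [Fa ab]]] := IH _ _ Fs Fc.
(* The strip closes [r] by [d] against [t] followed by [c]; the induction hypothesis closes [c] by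
   [b] against the rest of [s]. Appending [b] to the strip joins the two. *)
exists a, (d ++ b); rewrite /= -cat_rcons; split=> //.
have Fb := adjacent_star_FS ab Fa; apply: rt_trans ab _.
rewrite catA in Fb *; rewrite (catA r) (catA p).
by have [] := adjacent_star_catr cd Fb.
Qed.

Lemma FS_run_partial_FS_run : FS_run (@partial_FS_run N).
Proof.
split=> //.
- by exists (FS_class [::]), [::] => //; exists (@initial N).
- by move=> C D _ [s [r [Fs _ -> _ _]]]; exists s.
move=> _ _ [s Fs ->] [r Fr ->].
(* With the empty common prefix, confluence makes the class of [r ++ b] an upper bound of both
   classes. *)
have [a [b []]] := @FS_confluent [::] s r Fs Fr; rewrite !cat0s => Fa ab.
have Fb := adjacent_star_FS ab Fa.
exists (FS_class (r ++ b)); first by exists (r ++ b).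
by split; [exact: run_prefix_catr Fa ab | apply: run_prefix_catr Fb _; exact: rt_refl].
Qed.

End Nets.

Theorem theorem2 (N : net) :
  binary_conflict_free N -> exists! R, @maximal_FS_run N R.
Proof.
move=> bcf; have runP := FS_run_partial_FS_run bcf.
(* Every FS-run lies inside this set, which is itself an FS-run, so any maximal one equals it. *)
exists (@partial_FS_run N); split=> [|R [[sub _ _ _] maxR]]; last exact: maxR.
split=> // R [subR _ _ _] sub.
by apply/seteqP; split.
Qed.
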